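(* (Poincaré linearization theorem in characteristic $p$.) Let $p$ be a prime and let $\mathsf v=\sum_{i=1}^n\mathsf v_i(x)\frac{\partial}{\partial x_i}$, $\mathsf v_i\in\mathbb F_p[[x_1,\dots,x_n]]$, be a vector field in $(\mathbb A^{n,\mathrm{for}}_{\mathbb F_p},0):=\mathrm{Spec}\,\mathbb F_p[[x_1,\dots,x_n]]$. Let $\mathsf w=\sum_{i=1}^n\mathsf w_i(x)\frac{\partial}{\partial x_i}$ be its linear part, where $\mathsf w_i$ is the linear part of $\mathsf v_i$, and let $A$ be the $n\times n$ matrix with entries in $\mathbb F_p$ such that $\mathsf w(x)=Ax$, $x=[x_1,\dots,x_n]^{t}$. Assume $A^{p-1}=I_{n\times n}$. Then there is an isomorphism $f:(\mathbb A^{n,\mathrm{for}}_{\mathbb F_p},0)\to(\mathbb A^{n,\mathrm{for}}_{\mathbb F_p},0)$ tangent to the identity and sending $\mathsf v$ to $\mathsf w$ if and only if $\mathsf v^p=\mathsf v$.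
   Context: A vector field is viewed as a derivation of $\mathbb F_p[[x_1,\dots,x_n]]$, and $\mathsf v^p$ is its $p$-fold iterate (again a derivation in characteristic $p$). An isomorphism $f$ is given in coordinates by power series $f_i=f^*x_i\in\mathbb F_p[[x]]$; it is tangent to the identity if $f_i=x_i+(\text{terms of order}\ge2)$ for all $i$; it sends $\mathsf v$ to $\mathsf w$ if $\mathsf v(f_i)=\mathsf w_i(f_1,\dots,f_n)$ for all $i$, i.e. $\mathsf v(f)=Af$ with $f=[f_1,\dots,f_n]^{t}$.
   Formalization: The vector field v is additionally assumed to vanish at the origin, v_i(0)=0; without this the claim fails, e.g. for n=1 and v=(1+x)d/dx, where A=1 and v^p=v but no f tangent to the identity satisfies v(f)=Af. *)

(* Defs.v *)
From HB Require Import structures.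
From mathcomp Require Import all_boot all_order all_algebra.
From mathcomp Require Import boolp mpoly.

Set Implicit Arguments.
Unset Strict Implicit.
Unset Printing Implicit Defensive.

Import GRing.Theory.
Local Open Scope ring_scope.

(** * The ring R[[x_1, ..., x_n]] *)

Record mfps (n : nat) (R : Type) := MFPS { mfps_coef :> 'X_{1..n} -> R }.

Notation "{ 'fps' R [ n ] }" := (mfps n R)
  (at level 0, R, n at level 2, format "{ 'fps'  R [ n ] }") : type_scope.

HB.instance Definition _ n R := [isNew for @mfps_coef n R].
HB.instance Definition _ n (R : choiceType) := [Equality of {fps R[n]} by <:].
HB.instance Definition _ n (R : choiceType) := [Choice of {fps R[n]} by <:].

Lemma mfpsP n R (f g : {fps R[n]}) : f =1 g <-> f = g.
Proof.
split=> [eq_fg|-> //]; case: f g eq_fg => [f] [g] /= eq_fg.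
by congr MFPS; apply: funext.
Qed.

Section Ring.
Context (n : nat) (R : comNzRingType).
Implicit Types (f g h : {fps R[n]}) (m : 'X_{1..n}) (a b : R).

Definition mfps0 : {fps R[n]} := MFPS (fun=> 0).
Definition mfps_opp f : {fps R[n]} := MFPS (fun m => - f m).
Definition mfps_add f g : {fps R[n]} := MFPS (fun m => f m + g m).

Fact mfps_addA : associative mfps_add.
Proof. by move=> f g h; apply/mfpsP => m /=; rewrite addrA. Qed.
Fact mfps_addC : commutative mfps_add.
Proof. by move=> f g; apply/mfpsP => m /=; rewrite addrC. Qed.
Fact mfps_add0 : left_id mfps0 mfps_add.
Proof. by move=> f; apply/mfpsP => m /=; rewrite add0r. Qed.
Fact mfps_addN : left_inverse mfps0 mfps_opp mfps_add.
Proof. by move=> f; apply/mfpsP => m /=; rewrite addNr. Qed.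

HB.instance Definition _ := GRing.isZmodule.Build {fps R[n]}
  mfps_addA mfps_addC mfps_add0 mfps_addN.

(* The bound on k only makes the index type finite. *)
Definition mfps_mul f g : {fps R[n]} := MFPS (fun m =>
  \sum_(k : 'X_{1..n < (mdeg m).+1, (mdeg m).+1} | m == (k.1 + k.2)%MM)
     f k.1 * g k.2).

Definition mfps1 : {fps R[n]} := MFPS (fun m => (m == 0%MM)%:R).

Definition mfps_trunc d f : {mpoly R[n]} :=
  \sum_(m : 'X_{1..n < d}) f m *: 'X_[m].

Fact mcoeff_trunc d f m : (mdeg m < d)%N -> (mfps_trunc d f)@_m = f m.
Proof. by move=> lt_md; rewrite mcoeff_mpoly. Qed.

Fact mfps_mulE (P Q : {mpoly R[n]}) f g m :
    (forall k, (mdeg k <= mdeg m)%N -> P@_k = f k) ->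
    (forall k, (mdeg k <= mdeg m)%N -> Q@_k = g k) ->
  mfps_mul f g m = (P * Q)@_m.
Proof.
move=> eqP eqQ; rewrite mcoeffM; apply: eq_bigr => k _.
by rewrite eqP ?eqQ // -ltnS bmdeg.
Qed.

Fact mfps_mul_trunc d f g m : (mdeg m < d)%N ->
  mfps_mul f g m = (mfps_trunc d f * mfps_trunc d g)@_m.
Proof.
move=> lt_md; apply: mfps_mulE => k le_km;
  by rewrite mcoeff_trunc // (leq_ltn_trans le_km).
Qed.

Fact mfps_mulA : associative mfps_mul.
Proof.
move=> f g h; apply/mfpsP => m; set d := (mdeg m).+1.
rewrite (@mfps_mulE (mfps_trunc d f) (mfps_trunc d g * mfps_trunc d h)).
- rewrite (@mfps_mulE (mfps_trunc d f * mfps_trunc d g) (mfps_trunc d h)).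
  + by rewrite mulrA.
  + by move=> k le_km; rewrite (@mfps_mul_trunc d).
  + by move=> k le_km; rewrite mcoeff_trunc.
- by move=> k le_km; rewrite mcoeff_trunc.
- by move=> k le_km; rewrite (@mfps_mul_trunc d).
Qed.

Fact mfps_mulC : commutative mfps_mul.
Proof.
by move=> f g; apply/mfpsP => m; rewrite !(mfps_mul_trunc _ _ (ltnSn _)) mulrC.
Qed.

Fact mfps_mul1 : left_id mfps1 mfps_mul.
Proof.
move=> f; apply/mfpsP => m.
rewrite (@mfps_mulE 1 (mfps_trunc (mdeg m).+1 f)).
- by rewrite mul1r mcoeff_trunc.
- by move=> k _; rewrite mcoeff1.
- by move=> k le_km; rewrite mcoeff_trunc.
Qed.

Fact mfps_mulDl : left_distributive mfps_mul mfps_add.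
Proof.
move=> f g h; apply/mfpsP => m /=; rewrite -big_split /=.
by apply: eq_bigr => k _; rewrite mulrDl.
Qed.

Fact mfps1_neq0 : mfps1 != 0.
Proof.
apply/eqP => /mfpsP/(_ 0%MM) /eqP; rewrite /= eqxx.
by rewrite oner_eq0.
Qed.

HB.instance Definition _ := GRing.Zmodule_isComNzRing.Build {fps R[n]}
  mfps_mulA mfps_mulC mfps_mul1 mfps_mulDl mfps1_neq0.

Definition mfps_scale a f : {fps R[n]} := MFPS (fun m => a * f m).

Fact mfps_scaleA a b f :
  mfps_scale a (mfps_scale b f) = mfps_scale (a * b) f.
Proof. by apply/mfpsP => m /=; rewrite mulrA. Qed.
Fact mfps_scale1 : left_id 1 mfps_scale.
Proof. by move=> f; apply/mfpsP => m /=; rewrite mul1r. Qed.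
Fact mfps_scaleDr : right_distributive mfps_scale +%R.
Proof. by move=> a f g; apply/mfpsP => m /=; rewrite mulrDr. Qed.
Fact mfps_scaleDl f : {morph mfps_scale^~ f : a b / a + b}.
Proof. by move=> a b; apply/mfpsP => m /=; rewrite mulrDl. Qed.

HB.instance Definition _ := GRing.Zmodule_isLmodule.Build R {fps R[n]}
  mfps_scaleA mfps_scale1 mfps_scaleDr mfps_scaleDl.

Fact mfps_scaleAl a f g : a *: (f * g) = (a *: f) * g.
Proof.
apply/mfpsP => m /=; rewrite big_distrr /=.
by apply: eq_bigr => k _; rewrite mulrA.
Qed.

HB.instance Definition _ :=
  GRing.Lmodule_isLalgebra.Build R {fps R[n]} mfps_scaleAl.
HB.instance Definition _ := GRing.Lalgebra_isComAlgebra.Build R {fps R[n]}.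

Definition mfpsX (i : 'I_n) : {fps R[n]} := MFPS (fun m => (m == U_(i)%MM)%:R).

Definition hpart (d : nat) f : {fps R[n]} :=
  MFPS (fun m => if mdeg m == d then f m else 0).

Definition order_ge (d : nat) f := forall m, (mdeg m < d)%N -> f m = 0.

(* d/dx_i *)
Definition pderiv (i : 'I_n) f : {fps R[n]} :=
  MFPS (fun m => f (m + U_(i))%MM *+ (m i).+1).

End Ring.

Arguments mfpsX {n R} i.

Section Geometry.
Context (n : nat) (R : comNzRingType).

(** A tuple [v] stands for the vector field [\sum_i v_i d/dx_i]. *)
Definition vf_der (v : 'I_n -> {fps R[n]}) (g : {fps R[n]}) : {fps R[n]} :=
  \sum_(i < n) v i * pderiv i g.

(** [pullback f g = f^* g = g(f_1, ..., f_n)], for [f_i] without constant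
    term.  The coefficient of [x^m] is then that of the finite sum of the
    [g_k f_1^k_1 ... f_n^k_n] over [|k| <= |m|]: the other terms have order
    greater than [|m|].  If some [f_i] has a constant term, this is a junk
    value. *)
Definition pullback (f : 'I_n -> {fps R[n]}) (g : {fps R[n]}) : {fps R[n]} :=
  MFPS (fun m =>
    (\sum_(k : 'X_{1..n < (mdeg m).+1}) g k *: \prod_(i < n) f i ^+ k i) m).

(** Pointed morphisms of the formal affine space are the tuples [f] with
    [f(0) = 0]; such an [f] is an isomorphism when the ring morphism [f^*] is
    bijective. *)
Definition formal_iso (f : 'I_n -> {fps R[n]}) :=
  (forall i, f i 0%MM = 0) /\ bijective (pullback f).

Definition tangent_to_id (f : 'I_n -> {fps R[n]}) :=
  forall i, order_ge 2 (f i - mfpsX i).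

(** [f] sends the vector field [v] to [w]: [v(f_i) = w_i(f_1, ..., f_n)]. *)
Definition sends_vf (f v w : 'I_n -> {fps R[n]}) :=
  forall i, vf_der v (f i) = pullback f (w i).

Definition linear_part (v : 'I_n -> {fps R[n]}) : 'I_n -> {fps R[n]} :=
  fun i => hpart 1 (v i).

End Geometry.

(* Main.v *)
From HB Require Import structures.
Require Import Defs.
From mathcomp Require Import all_boot all_order all_algebra.
From mathcomp Require Import ssrcomplements mpoly.

Set Implicit Arguments.
Unset Strict Implicit.
Unset Printing Implicit Defensive.

Import GRing.Theory.
Local Open Scope ring_scope.

(** Write [D] for the derivation of a vector field [v] with linear part [A x].

    Suppose that [f] is an isomorphism with [D f_i = \sum_j A_ij f_j]. Then
    [D^p f = A^p f = A f = D f], because [A^(p-1) = 1]. In characteristic [p]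
    the operator [D^p - D] is a derivation ([iter_derivM_pchar]). It kills all
    [f_i] and does not lower orders, hence it kills every power series in the
    [f_i] ([deriv_pullback_eq0]), and these are all power series since [f^*] is
    surjective.

    Conversely, if [D^p = D], then [D] is diagonalizable on every space of jets,
    with eigenvalues in [F_p], and so is [A], with nonzero eigenvalues. The
    commuting operators [D] and [A] act on [n]-tuples of power series, and a
    linearizing [f] is obtained by projecting the tuple of coordinates [x] to
    the tuples on which [D] and [A] agree. As [A^(p-1) = 1], that projection
    is [- \sum_(1 <= k < p) A^(p-1-k) D^k], an explicit sum
    ([linearization]) whose properties follow from [D^p = D] alone. It satisfies
    [D f = A f] ([vf_der_linearization]) and is tangent to the identity
    ([linearization_tangent]).

    It remains to see that a tuple [f] tangent to the identity is an isomorphism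
    ([tangent_formal_iso]). The operator [1 - f^*] raises the order
    ([pullback_tangent]), so that [f^*] is inverted by a Neumann series
    ([bijective_sub_raising]). *)

(** * Iterates of a derivation *)

Section Derivation.
Context (S : comNzRingType) (D : {additive S -> S}).
Hypothesis DM : forall x y, D (x * y) = D x * y + x * D y.

(** [D] acts on a product as the sum of its actions on the two factors; these
    commute, so the binomial theorem applies. *)
Lemma iter_derivM k x y :
  iter k D (x * y) = \sum_(i < k.+1) iter (k - i) D x * iter i D y *+ 'C(k, i).
Proof.
elim: k => [|k IHk]; first by rewrite big_ord_recl big_ord0 addr0.
rewrite iterS {}IHk raddf_sum /=.
under eq_bigr => i _ do rewrite raddfMn DM mulrnDl /= -2!iterS.
rewrite big_split /= big_ord_recl [RHS]big_ord_recl /= !subn0 !bin0.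
rewrite [X in _ + X]big_ord_recr [X in _ = _ + X]big_ord_recr /= !subnn !binn.
rewrite -addrA; congr (_ + _); rewrite addrA -big_split /=; congr (_ + _).
apply: eq_bigr => i _; rewrite /bump /= add1n subSS -iterS subnSK //.
by rewrite binS mulrnDr.
Qed.

(** The inner binomial coefficients [C(p, i)] vanish in characteristic [p]. *)
Lemma iter_derivM_pchar p x y : p \in [pchar S] ->
  iter p D (x * y) = iter p D x * y + x * iter p D y.
Proof.
move=> pcharSp; have p_prime := pcharf_prime pcharSp.
have p_gt0 := prime_gt0 p_prime.
case: p pcharSp p_prime p_gt0 => // p pcharSp p_prime _.
rewrite iter_derivM big_ord_recl big_ord_recr /=.
rewrite /bump add1n subnn binn big1 ?add0r // => i _.
have: (p.+1 %| 'C(p.+1, i.+1))%N by rewrite prime_dvd_bin //= ltnS ltn_ord.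
by rewrite (dvdn_pcharf pcharSp) => /eqP bin_eq0;
  rewrite -mulr_natr bin_eq0 mulr0.
Qed.
End Derivation.

(** * Orders of power series *)

Section Order.
Context (n : nat) (R : comNzRingType).
Implicit Types (a b g h : {fps R[n]}) (m k : 'X_{1..n}) (d s t : nat).

Lemma mfps_sumE I (r : seq I) (P : pred I) (F : I -> {fps R[n]}) m :
  (\sum_(i <- r | P i) F i) m = \sum_(i <- r | P i) F i m.
Proof. by apply: (big_morph (fun g : {fps R[n]} => g m)). Qed.

Lemma order_geP g h : (forall d, order_ge d (g - h)) -> g = h.
Proof.
by move=> gh; apply/mfpsP => m; apply/subr0_eq/(gh (mdeg m).+1).
Qed.

Lemma order_ge_le s t g : (s <= t)%N -> order_ge t g -> order_ge s g.
Proof. by move=> le_st g_t m lt_ms; apply/g_t/(leq_trans lt_ms). Qed.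

Lemma order_geD d g h : order_ge d g -> order_ge d h -> order_ge d (g + h).
Proof.
by move=> g_d h_d m lt_md; rewrite /= g_d // h_d // addr0.
Qed.

Lemma order_geN d g : order_ge d g -> order_ge d (- g).
Proof. by move=> g_d m lt_md; rewrite /= g_d // oppr0. Qed.

Lemma order_geB d g h : order_ge d g -> order_ge d h -> order_ge d (g - h).
Proof. by move=> g_d /order_geN; apply: order_geD. Qed.

Lemma order_geZ d c g : order_ge d g -> order_ge d (c *: g).
Proof. by move=> g_d m lt_md; rewrite /= g_d // mulr0. Qed.

Lemma order_ge_sum d I (r : seq I) (P : pred I) (F : I -> {fps R[n]}) :
  (forall i, P i -> order_ge d (F i)) ->
  order_ge d (\sum_(i <- r | P i) F i).
Proof.
by move=> F_d; apply: big_ind => //; apply: order_geD.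
Qed.

Lemma order_geM s t g h :
  order_ge s g -> order_ge t h -> order_ge (s + t) (g * h).
Proof.
move=> g_s h_t m lt_m; apply: big1 => k /eqP m_k.
have [lt_s|le_s] := ltnP (mdeg k.1) s; first by rewrite g_s ?mul0r.
rewrite h_t ?mulr0 // -(ltn_add2l (mdeg k.1)) -mdegD -m_k.
by rewrite (leq_trans lt_m) // leq_add2r.
Qed.

(** The bound on the order of [b], which [a] inherits, makes this relation
    compatible with products. *)
Definition same_initial s a b := order_ge s b /\ order_ge s.+1 (a - b).

Lemma same_initial_order s a b : same_initial s a b -> order_ge s a.
Proof.
move=> [b_s /(order_ge_le (leqnSn s)) ab_s].
by rewrite -(subrK b a); apply: order_geD.
Qed.

Lemma same_initial1 : same_initial 0 1 1.
Proof. by split; rewrite ?subrr. Qed.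

Lemma same_initialM s t a b a' b' :
  same_initial s a b -> same_initial t a' b' ->
  same_initial (s + t) (a * a') (b * b').
Proof.
move=> [b_s ab] [b'_t ab']; split; first exact: order_geM.
have a'_t : order_ge t a' by apply: same_initial_order (conj b'_t ab').
have -> : a * a' - b * b' = (a - b) * a' + b * (a' - b').
  by rewrite mulrBl mulrBr addrA subrK.
by apply: order_geD; [rewrite -addSn|rewrite -addnS]; apply: order_geM.
Qed.

Lemma same_initialX a b e :
  same_initial 1 a b -> same_initial e (a ^+ e) (b ^+ e).
Proof.
move=> ab; elim: e => [|e IHe]; first exact: same_initial1.
by rewrite !exprS -add1n; apply: same_initialM.
Qed.

Lemma same_initial_monomial (f h : 'I_n -> {fps R[n]}) k :
  (forall i, same_initial 1 (f i) (h i)) ->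
  same_initial (mdeg k) (\prod_(i < n) f i ^+ k i) (\prod_(i < n) h i ^+ k i).
Proof.
move=> fh; rewrite mdegE; apply: (big_ind3 same_initial).
- exact: same_initial1.
- by move=> *; apply: same_initialM.
- by move=> i _; apply: same_initialX.
Qed.

Lemma order_ge_monomial (f : 'I_n -> {fps R[n]}) k :
  (forall i, order_ge 1 (f i)) -> order_ge (mdeg k) (\prod_(i < n) f i ^+ k i).
Proof.
move=> f_1; apply: (@same_initial_order _ _ (\prod_(i < n) f i ^+ k i)).
by apply: same_initial_monomial => i; split; rewrite ?subrr.
Qed.

(** If [N] raises the order, the inverse of [1 - N] is the Neumann series
    [1 + N + N^2 + ...], whose coefficients stabilize. *)
Lemma bijective_sub_raising (N : {additive {fps R[n]} -> {fps R[n]}}) :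
    (forall d g, order_ge d g -> order_ge d.+1 (N g)) ->
  bijective (fun g => g - N g).
Proof.
move=> N_raises; pose psum d g := \sum_(k < d) iter k N g.
have iterN d g : order_ge d (iter d N g).
  by elim: d => // d IHd; rewrite iterS; apply: N_raises.
have psumK d g : psum d g - N (psum d g) = g - iter d N g.
  rewrite /psum; elim: d => [|d IHd]; first by rewrite big_ord0 raddf0 !subrr.
  rewrite big_ord_recr /= raddfD opprD addrACA IHd.
  by rewrite addrA subrK.
have psum_stable m d g : (mdeg m < d)%N -> psum d g m = psum (mdeg m).+1 g m.
  elim: d => // d IHd; rewrite ltnS leq_eqVlt => /predU1P[->//|lt_md].
  by rewrite -IHd // /psum big_ord_recr /= (iterN d) // addr0.
pose inv g : {fps R[n]} := MFPS (fun m => psum (mdeg m).+1 g m).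
have inv_psum d g : order_ge d (inv g - psum d g).
  by move=> m lt_md; rewrite /= (psum_stable _ d) // subrr.
have invK g : inv g - N (inv g) = g.
  apply: order_geP => d; have := inv_psum d g.
  move: (inv g - _) (esym (subrK (psum d g) (inv g))) => r -> r_d.
  rewrite raddfD opprD addrACA psumK addrA addrAC addrK.
  apply: order_geB; last exact: iterN.
  by apply: order_geB => //; apply: order_ge_le (N_raises _ _ r_d).
(* The difference of the two sides is fixed by [N], so it has order at least
   [d] for all [d]. *)
exists inv => // g; apply: order_geP; elim=> // d /N_raises.
rewrite raddfB; congr order_ge.
have /eqP := invK (g - N g); rewrite subr_eq => /eqP; move: (inv _) => h {2}->.
by rewrite [RHS]addrC !addrA addNr add0r addrC.
Qed.
End Order.

(** * Substitution *)

Section Pullback.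
Context (n : nat) (R : comNzRingType).
Implicit Types (f : 'I_n -> {fps R[n]}) (g h : {fps R[n]}).
Implicit Types (P Q : {mpoly R[n]}).
Implicit Types (m k : 'X_{1..n}).

Definition mfps_of_mpoly P : {fps R[n]} := MFPS (fun m => P@_m).

Lemma mfps_of_mpolyM P Q :
  mfps_of_mpoly (P * Q) = mfps_of_mpoly P * mfps_of_mpoly Q.
Proof. by apply/mfpsP => m; apply/esym/mfps_mulE. Qed.

Lemma mfps_of_mpoly1 : mfps_of_mpoly 1 = 1.
Proof. by apply/mfpsP => m /=; rewrite mcoeff1. Qed.

Lemma mfpsXE i : mfpsX i = mfps_of_mpoly 'X_i.
Proof. by apply/mfpsP => m /=; rewrite mcoeffX eq_sym. Qed.

Lemma monomialE k m :
  (\prod_(i < n) mfpsX i ^+ k i : {fps R[n]}) m = (m == k)%:R.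
Proof.
suff -> : \prod_(i < n) mfpsX i ^+ k i = mfps_of_mpoly 'X_[k].
  by rewrite /= mcoeffX eq_sym.
rewrite mpolyXE_id (big_morph _ mfps_of_mpolyM mfps_of_mpoly1).
apply: eq_bigr => i _; rewrite mfpsXE; elim: (k i) => [|e IHe].
  by rewrite !expr0 mfps_of_mpoly1.
by rewrite !exprS mfps_of_mpolyM IHe.
Qed.

Lemma order_ge_mfpsX i : order_ge 1 (mfpsX i : {fps R[n]}).
Proof.
move=> m; rewrite ltnS leqn0 => /eqP m0 /=.
by case: eqP m0 => // ->; rewrite mdeg1.
Qed.

Lemma pullback_is_linear f : linear (pullback f).
Proof.
move=> c g h; apply/mfpsP => m /=; rewrite !mfps_sumE mulr_sumr -big_split /=.
by apply: eq_bigr => k _; rewrite mulrDl mulrA.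
Qed.

HB.instance Definition _ f := GRing.isLinear.Build R {fps R[n]} {fps R[n]} _
  (pullback f) (pullback_is_linear f).

(** Monomials of degree [> |m|] in the [f_i] do not contribute to the
    coefficient of [x^m], so a single truncation serves for all coefficients of
    degree less than [d], where the definition truncates at [|m| + 1]. *)
Lemma pullback_truncE f g d m :
  (forall i, order_ge 1 (f i)) -> (mdeg m < d)%N ->
  pullback f g m =
    (\sum_(k : 'X_{1..n < d}) g k *: \prod_(i < n) f i ^+ k i) m.
Proof.
move=> f_1 lt_md; rewrite /= !mfps_sumE.
pose F k := (g k *: \prod_(i < n) f i ^+ k i) m.
rewrite (eq_big_widen 'X_{1..n < (mdeg m).+1} 'X_{1..n < d}
  (P := xpredT) (F := F)) //.
  by move=> k /leq_trans; apply.
move=> k; rewrite -leqNgt /F => lt_mk.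
by rewrite /= (order_ge_monomial f_1) // mulr0.
Qed.

Lemma pullback_mfpsX f j : order_ge 1 (f j) -> pullback f (mfpsX j) = f j.
Proof.
move=> f_1; apply/mfpsP => m; rewrite /= mfps_sumE.
have [lt_m1|lt_1m] := leqP (mdeg m) 0.
  rewrite f_1 // big1 // => k _ /=.
  case: eqP (bmdeg k) => [->|_ _]; last by rewrite mul0r.
  by rewrite mdeg1 ltnS leqNgt ltnS lt_m1.
have lt_jm : (mdeg U_(j) < (mdeg m).+1)%N by rewrite mdeg1.
have prodE : \prod_(i < n) f i ^+ U_(j)%MM i = f j.
  rewrite (bigD1 j) //= mnm1E eqxx expr1 big1 ?mulr1 // => i /negPf neq_ij.
  by rewrite mnm1E eq_sym neq_ij.
rewrite (bigD1 (BMultinom lt_jm)) //= eqxx mul1r prodE big1 ?addr0 //.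
by move=> k /negPf neq_kj; rewrite [_ == _]neq_kj mul0r.
Qed.

Lemma tangent_to_id_order f : tangent_to_id f -> forall i, order_ge 1 (f i).
Proof.
move=> f_id i; rewrite -(subrK (mfpsX i) (f i)).
by apply: order_geD; [apply: order_ge_le (f_id i)|apply: order_ge_mfpsX].
Qed.

(** The initial form of [f_1^k_1 ... f_n^k_n] is [x^k], so [f^*] preserves the
    part of lowest degree of a power series. *)
Lemma pullback_tangent f d g : tangent_to_id f -> order_ge d g ->
  order_ge d.+1 (g - pullback f g).
Proof.
move=> f_id g_d m; rewrite ltnS => le_md; rewrite /= mfps_sumE.
have lt_mm := ltnSn (mdeg m).
rewrite (bigD1 (BMultinom lt_mm)) //=.
have f1 k : same_initial (mdeg k)
    (\prod_(i < n) f i ^+ k i) (\prod_(i < n) mfpsX i ^+ k i).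
  by apply: same_initial_monomial => i; split;
    [apply: order_ge_mfpsX|apply: f_id].
have coefE k : (mdeg m <= mdeg k)%N ->
    (\prod_(i < n) f i ^+ k i) m = (m == k)%:R.
  move=> le_mk; apply/eqP; rewrite -monomialE -subr_eq0; apply/eqP.
  by have [_] := f1 k; apply; rewrite ltnS.
rewrite coefE // eqxx mulr1 big1 ?addr0 ?subrr // => k neq_km.
have [lt_kd|le_dk] := ltnP (mdeg k) d; first by rewrite g_d ?mul0r.
rewrite coefE ?(leq_trans le_md) // eq_sym.
by rewrite [_ == _](negPf neq_km) mulr0.
Qed.

Lemma tangent_formal_iso f : tangent_to_id f -> formal_iso f.
Proof.
move=> f_id; split=> [i|]; first by rewrite tangent_to_id_order ?mdeg0.
have := @bijective_sub_raising _ _ (idfun \- pullback f)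
  (fun d g => @pullback_tangent f d g f_id).
by move/eq_bij; apply=> g /=; rewrite opprB addrC subrK.
Qed.

End Pullback.

(** * Vector fields *)

Section VectorField.
Context (n : nat) (R : comNzRingType).
Implicit Types (f u v : 'I_n -> {fps R[n]}) (g h : {fps R[n]}).
Implicit Types (M N : 'M[R]_n).

Lemma pderiv_is_linear i : linear (@pderiv n R i).
Proof.
by move=> c g h; apply/mfpsP => m /=; rewrite mulrnDl mulrnAr.
Qed.

HB.instance Definition _ i := GRing.isLinear.Build R {fps R[n]} {fps R[n]} _
  (@pderiv n R i) (pderiv_is_linear i).

(** Each coefficient of [g * h] depends on finitely many coefficients of [g]
    and [h], so that the Leibniz rule for polynomials applies to truncations. *)
Lemma pderivM i g h : pderiv i (g * h) = pderiv i g * h + g * pderiv i h.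
Proof.
apply/mfpsP => m; pose d := (mdeg m).+2.
have truncE a k : (mdeg k <= (mdeg m).+1)%N -> (mfps_trunc d a)@_k = a k.
  by move=> le_km; rewrite mcoeff_trunc.
have derivE a k : (mdeg k <= mdeg m)%N ->
    (mfps_trunc d a)^`M(i)@_k = pderiv i a k.
  by move=> le_km; rewrite mcoeff_deriv truncE // mdegD mdeg1 addn1.
have mdegS : mdeg (m + U_(i)) = (mdeg m).+1 by rewrite mdegD mdeg1 addn1.
rewrite [LHS](_ : _ = (mfps_trunc d g * mfps_trunc d h)^`M(i)@_m); last first.
  rewrite mcoeff_deriv /= -(@mfps_mulE _ _ _ _ g h) // => k; rewrite mdegS.
  + exact: truncE.
  + exact: truncE.
rewrite mderivM mcoeffD; congr (_ + _); apply/esym/mfps_mulE => k le_km.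
- exact: derivE.
- by apply: truncE; apply: leqW.
- by apply: truncE; apply: leqW.
- exact: derivE.
Qed.

Lemma pderiv_mfpsX i j : pderiv i (mfpsX j : {fps R[n]}) = (i == j)%:R.
Proof.
apply/mfpsP => m /=; have [->|/eqP neq_ij] := eqVneq i j.
  rewrite -{2}[U_(j)%MM]add0m eqm_add2r.
  by case: eqP => [->|]; rewrite ?mnm0E ?mul0rn //= mulrb; case: eqP.
case: eqP => [/mnmP/(_ i)|_]; last by rewrite mul0rn.
by rewrite mnmDE !mnm1E eqxx addn1 eq_sym; case: eqP.
Qed.

Lemma vf_der_is_linear v : linear (vf_der v).
Proof.
move=> c g h; rewrite /vf_der scaler_sumr -big_split /=.
by apply: eq_bigr => i _; rewrite linearP mulrDr scalerAr.
Qed.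

HB.instance Definition _ v := GRing.isLinear.Build R {fps R[n]} {fps R[n]} _
  (vf_der v) (vf_der_is_linear v).

Lemma vf_derM v g h : vf_der v (g * h) = vf_der v g * h + g * vf_der v h.
Proof.
rewrite /vf_der mulr_suml mulr_sumr -big_split /=.
by apply: eq_bigr => i _; rewrite pderivM mulrDr mulrA [v i * (g * _)]mulrCA.
Qed.

Lemma vf_der_mfpsX v j : vf_der v (mfpsX j) = v j.
Proof.
rewrite /vf_der (bigD1 j) //= pderiv_mfpsX eqxx mulr1 big1 ?addr0 //.
by move=> i /negPf neq_ij; rewrite pderiv_mfpsX neq_ij mulr0.
Qed.

Lemma order_ge_vf_der v d g : (forall i, order_ge 1 (v i)) ->
  order_ge d g -> order_ge d (vf_der v g).
Proof.
move=> v_1 g_d; apply: order_ge_sum => i _.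
case: d g_d => // d g_d; rewrite -add1n; apply: order_geM => // m lt_md.
by rewrite /= g_d ?mul0rn // mdegD mdeg1 addn1.
Qed.

Lemma iter_vf_der_is_linear v k : linear (iter k (vf_der v)).
Proof. by elim: k => // k IHk c g h; rewrite /= IHk linearP. Qed.

HB.instance Definition _ v k := GRing.isLinear.Build R {fps R[n]} {fps R[n]} _
  (iter k (vf_der v)) (iter_vf_der_is_linear v k).

Lemma order_ge_iter_vf_der v k d g : (forall i, order_ge 1 (v i)) ->
  order_ge d g -> order_ge d (iter k (vf_der v) g).
Proof. by move=> v_1 g_d; elim: k => //= k; apply: order_ge_vf_der. Qed.

Lemma pchar_mfps p : p \in [pchar R] -> p \in [pchar {fps R[n]}].
Proof.
move=> pcharRp; rewrite inE (pcharf_prime pcharRp).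
by rewrite -scaler_nat (pcharf0 pcharRp) scale0r eqxx.
Qed.

(** A derivation vanishing on the [f_i] vanishes on polynomials in the [f_i];
    as it does not lower orders, it is continuous, and so vanishes on all power
    series in the [f_i]. *)
Lemma deriv_pullback_eq0 (E : {linear {fps R[n]} -> {fps R[n]}}) f g :
    (forall a b, E (a * b) = E a * b + a * E b) ->
    (forall d a, order_ge d a -> order_ge d (E a)) ->
    (forall i, order_ge 1 (f i)) -> (forall i, E (f i) = 0) ->
  E (pullback f g) = 0.
Proof.
move=> EM E_order f_1 Ef.
have E1 : E 1 = 0.
  by apply: (addrI (E 1)); have := EM 1 1; rewrite !mulr1 mul1r addr0 => <-.
have EMon (k : 'X_{1..n}) : E (\prod_(i < n) f i ^+ k i) = 0.
  apply: (big_ind (fun a => E a = 0)) => // [a b Ea Eb|i _].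
    by rewrite EM Ea Eb mul0r mulr0 addr0.
  by elim: (k i) => // e IHe; rewrite exprS EM Ef IHe mul0r mulr0 addr0.
apply: order_geP => d; rewrite subr0.
pose S := \sum_(k : 'X_{1..n < d}) g k *: \prod_(i < n) f i ^+ k i.
have ES : E S = 0.
  by rewrite linear_sum big1 // => k _; rewrite linearZ /= EMon scaler0.
rewrite -(subrK S (pullback f g)) linearD ES addr0; apply: E_order => m lt_md.
have /eqP := pullback_truncE g f_1 lt_md.
by rewrite -subr_eq0 => /eqP.
Qed.

Definition mxact M u : 'I_n -> {fps R[n]} := fun i => \sum_(j < n) M i j *: u j.

Lemma eq_mxact M u v : u =1 v -> mxact M u =1 mxact M v.
Proof. by move=> uv i; apply: eq_bigr => j _; rewrite uv. Qed.

Lemma mxactM M N u : mxact (M *m N) u =1 mxact M (mxact N u).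
Proof.
move=> i; rewrite /mxact.
under eq_bigr => j _ do rewrite mxE scaler_suml.
rewrite exchange_big /=; apply: eq_bigr => j _; rewrite scaler_sumr.
by apply: eq_bigr => k _; rewrite scalerA.
Qed.

Lemma mxact1 u : mxact 1%:M u =1 u.
Proof.
move=> i; rewrite /mxact (bigD1 i) //= mxE eqxx scale1r big1 ?addr0 //.
by move=> j /negPf neq_ji; rewrite mxE eq_sym neq_ji scale0r.
Qed.

Lemma mxactN M u i : mxact M (fun j => - u j) i = - mxact M u i.
Proof. by rewrite /mxact -sumrN; apply: eq_bigr => j _; rewrite scalerN. Qed.

Lemma mxact_sum M I (r : seq I) (P : pred I) (F : I -> 'I_n -> {fps R[n]}) i :
  mxact M (fun j => \sum_(k <- r | P k) F k j) i =
    \sum_(k <- r | P k) mxact M (F k) i.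
Proof.
rewrite /mxact [RHS]exchange_big /=.
by apply: eq_bigr => j _; rewrite scaler_sumr.
Qed.

Lemma mxactB M u v i :
  mxact M u i - mxact M v i = mxact M (fun j => u j - v j) i.
Proof. by rewrite /mxact -sumrB; apply: eq_bigr => j _; rewrite scalerBr. Qed.

Lemma order_ge_mxact M u d i :
  (forall j, order_ge d (u j)) -> order_ge d (mxact M u i).
Proof. by move=> u_d; apply: order_ge_sum => j _; apply: order_geZ. Qed.

Lemma linear_mxact (E : {linear {fps R[n]} -> {fps R[n]}}) M u i :
  E (mxact M u i) = mxact M (E \o u) i.
Proof. by rewrite linear_sum; apply: eq_bigr => j _; rewrite linearZ. Qed.

Lemma pullback_mxact_mfpsX f M i : (forall j, order_ge 1 (f j)) ->
  pullback f (mxact M mfpsX i) = mxact M f i.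
Proof.
by move=> f_1; rewrite linear_mxact; apply: eq_mxact => j;
  apply: pullback_mfpsX.
Qed.

End VectorField.

(** * Linearization *)

Section Linearization.
Context (n : nat) (R : comNzRingType) (p : nat).
Context (v : 'I_n -> {fps R[n]}) (A : 'M[R]_n).
Hypothesis pcharRp : p \in [pchar R].
Hypothesis v_0 : forall i, v i 0%MM = 0.
Hypothesis v_lin : forall i, linear_part v i = \sum_(j < n) A i j *: mfpsX j.
Hypothesis A_pow : A ^+ p.-1 = 1%:M.

Local Notation D := (vf_der v).

Lemma linearizable_p_closed f g : formal_iso f -> tangent_to_id f ->
  sends_vf f v (linear_part v) -> iter p D g = D g.
Proof.
move=> [_ [finv _ finvK]] f_id f_sends.
have f_1 := tangent_to_id_order f_id.
have v_1 i : order_ge 1 (v i).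
  by move=> m; rewrite ltnS leqn0 mdeg_eq0 => /eqP ->; apply: v_0.
have Df i : D (f i) = mxact A f i.
  by rewrite f_sends v_lin -[RHS]pullback_mxact_mfpsX.
have iterDf k i : iter k D (f i) = mxact (A ^+ k) f i.
  elim: k i => [|k IHk] i; first by rewrite expr0 mxact1.
  rewrite iterS IHk linear_mxact exprSr mxactM.
  by apply: eq_mxact => j; apply: Df.
have p_gt0 : (0 < p)%N by rewrite prime_gt0 ?(pcharf_prime pcharRp).
have := @deriv_pullback_eq0 n R (iter p D \- D) f (finv g).
rewrite finvK /= => /(_ _ _ f_1) E0; apply/subr0_eq/E0 => [a b|d a a_d|i] /=.
- rewrite (iter_derivM_pchar (vf_derM v)) ?pchar_mfps // vf_derM.
  by rewrite mulrBl mulrBr opprD addrACA.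
- by apply: order_geB; [apply: order_ge_iter_vf_der|apply: order_ge_vf_der].
- by rewrite iterDf Df -[in A ^+ p](prednK p_gt0) exprS A_pow mulr1 subrr.
Qed.

(** The components of [- \sum_(1 <= k < p) A^(p-1-k) D^k x]. If [D^p = D] and
    [A^(p-1) = 1], then [D] sends each term to [A] times the next one,
    cyclically. The linear part of the sum is [-(p-1) A^(p-1) x = x]. *)
Definition linearization (i : 'I_n) : {fps R[n]} :=
  - \sum_(k < p.-1) mxact (A ^+ (p.-2 - k)) (fun j => iter k.+1 D (mfpsX j)) i.

Lemma vf_der_linearization i : (forall j, iter p D (mfpsX j) = D (mfpsX j)) ->
  D (linearization i) = mxact A linearization i.
Proof.
have [q p_q] : {q | p = q.+2}.
  by exists p.-2; rewrite -subn2 -addn2 subnK ?prime_gt1 ?(pcharf_prime pcharRp).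
move: A_pow; rewrite /linearization p_q /= => A_powq Dp.
rewrite (linearN D) (linear_sum D) /=.
rewrite mxactN mxact_sum; congr (- _).
under [RHS]eq_bigr => k _ do
  rewrite -mxactM mulmxE -exprS -subSn -1?ltnS ?ltn_ord //.
rewrite big_ord_recr [RHS]big_ord_recl addrC /=; congr (_ + _).
  by apply: eq_bigr => k _; rewrite (linear_mxact D).
rewrite (linear_mxact D) subnn expr0 mxact1 A_powq mxact1 /=.
exact: Dp.
Qed.

Lemma linearization_tangent : tangent_to_id linearization.
Proof.
have v_1 i : order_ge 1 (v i).
  by move=> m; rewrite ltnS leqn0 mdeg_eq0 => /eqP ->; apply: v_0.
have v_2 i : order_ge 2 (v i - mxact A mfpsX i).
  rewrite /mxact -v_lin => m lt_m2 /=.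
  case: eqP => [_|m_neq1]; first by rewrite subrr.
  by rewrite subr0 v_1 //; case: (mdeg m) lt_m2 m_neq1 => [|[]].
have iterD k i : order_ge 2 (iter k D (mfpsX i) - mxact (A ^+ k) mfpsX i).
  (* [D (A^k x) = A^k v = A^(k+1) x] modulo order 2. *)
  elim: k i => [|k IHk] i; first by rewrite expr0 mxact1 subrr.
  rewrite iterS -[iter k _ _](subrK (mxact (A ^+ k) mfpsX i)) linearD /= -addrA.
  apply: order_geD; first exact: order_ge_vf_der.
  rewrite linear_mxact exprSr mxactM mxactB; apply: order_ge_mxact => j /=.
  by rewrite vf_der_mfpsX.
have p_gt1 : (1 < p)%N by rewrite prime_gt1 ?(pcharf_prime pcharRp).
move=> i.
(* The sum has [p - 1] equal terms, and [-(p - 1) = 1]. *)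
have sumX : - \sum_(k < p.-1) mxact (A ^+ p.-1) mfpsX i = mfpsX i.
  rewrite A_pow mxact1 sumr_const card_ord; apply/esym/eqP.
  rewrite -addr_eq0 -mulrS prednK ?(ltnW p_gt1) // -scaler_nat.
  by rewrite (pcharf0 pcharRp) scale0r.
rewrite -sumX -opprD; apply: order_geN; rewrite -sumrB.
apply: order_ge_sum => k _.
have -> : A ^+ p.-1 = A ^+ (p.-2 - k) *m A ^+ k.+1.
  rewrite mulmxE -exprD; congr (_ ^+ _).
  have p1_gt0 : (0 < p.-1)%N by rewrite -subn1 subn_gt0.
  by rewrite addnS subnK ?prednK // -ltnS prednK.
by rewrite mxactM mxactB; apply: order_ge_mxact.
Qed.

End Linearization.

Theorem theorem6p9 (p : nat) (p_prime : prime p) (n : nat)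
    (v : 'I_n -> {fps 'F_p[n]})
    (v_vanishes_at_0 : forall i : 'I_n, v i 0%MM = 0)
    (A : 'M['F_p]_n)
    (linear_part_v : forall i : 'I_n,
       linear_part v i = \sum_(j < n) A i j *: mfpsX j)
    (A_pow : A ^+ p.-1 = 1%:M) :
  (exists f : 'I_n -> {fps 'F_p[n]},
     [/\ formal_iso f, tangent_to_id f & sends_vf f v (linear_part v)])
  <-> (forall g : {fps 'F_p[n]}, iter p (vf_der v) g = vf_der v g).
Proof.
have pcharFp := pchar_Fp p_prime.
split=> [[f [f_iso f_id f_sends]] g|v_closed].
  exact: (linearizable_p_closed pcharFp v_vanishes_at_0 linear_part_v A_pow)
    f_iso _ _.
have f_id := linearization_tangent pcharFp v_vanishes_at_0 linear_part_v A_pow.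
exists (linearization p v A); split=> // [|i]; first exact: tangent_formal_iso.
rewrite vf_der_linearization // linear_part_v.
exact/esym/pullback_mxact_mfpsX/tangent_to_id_order.
Qed.
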